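(* Let $\{M(t)\}_{t\ge0}$ be the generalized counting process with rates $\lambda_1,\dots,\lambda_k>0$, $\Lambda=\lambda_1+\cdots+\lambda_k$, let $\{D_f(t)\}_{t\ge0}$ be an independent Lévy subordinator with Bernstein function $f$, and let $M_f(t)=M(D_f(t))$. The density functions $\mathscr{P}_f(n,\cdot)$ of the first passage times $T_f^n=\inf\{s\ge0:M_f(s)\ge n\}$ solve the system of differential equations $$\frac{\mathrm{d}}{\mathrm{d}t}\mathscr{P}_{f}(n,t)=-f\bigg(\Lambda\Big(I-\frac{1}{\Lambda}\sum_{j=1}^{n\wedge k}\lambda_{j}B^{j}\Big)\bigg)\mathscr{P}_{f}(n,t),\quad n\ge1,$$ where $B$ is the backward shift operator, $B\mathscr{P}_f(n,t)=\mathscr{P}_f(n-1,t)$.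
   Context: Generalized counting process (GCP): the (càdlàg) Lévy process $\{M(t)\}_{t\ge0}$ with values in the non-negative integers, $M(0)=0$, and $\Pr\{M(t)=n\}=\sum_{\Omega(k,n)}\prod_{j=1}^{k}\frac{(\lambda_{j}t)^{x_{j}}}{x_{j}!}e^{-\Lambda t}$, where $\Omega(k,n)=\{(x_1,\dots,x_k): x_j\in\{0,1,2,\dots\},\ \sum_{j=1}^k jx_j=n\}$. Lévy subordinator: a (finite-valued, càdlàg) non-decreasing Lévy process with $\mathbb{E}(e^{-sD_f(t)})=e^{-tf(s)}$, where $f(s)=c_2s+\int_0^\infty(1-e^{-sx})\,\overline\nu(\mathrm{d}x)$, $c_2\ge0$, $\int_0^\infty(x\wedge1)\,\overline\nu(\mathrm{d}x)<\infty$, so that $f(0)=0$. The density is $\mathscr{P}_f(n,s)=\frac{\mathrm{d}}{\mathrm{d}s}\Pr\{M_f(s)\ge n\}$, $n\ge1$, with the convention $\mathscr{P}_f(n,t)=0$ for $n\le0$. The operator $f(A)$ with $A=\Lambda I-\sum_{j=1}^{n\wedge k}\lambda_jB^j$ is understood as $c_2A+\int_0^\infty(I-e^{-sA})\,\overline\nu(\mathrm{d}s)$ with $e^{-sA}$ expanded in powers of $B$; explicitly, $$f\bigg(\Lambda\Big(I-\frac{1}{\Lambda}\sum_{j=1}^{n\wedge k}\lambda_{j}B^{j}\Big)\bigg)\mathscr{P}_{f}(n,t)=f(\Lambda)\mathscr{P}_{f}(n,t)+\sum_{m=1}^{n}\sum_{\Omega(k,m)}f^{(z_{k})}(\Lambda)\prod_{j=1}^{k}\frac{(-\lambda_{j})^{x_{j}}}{x_{j}!}\,\mathscr{P}_{f}(n-m,t),$$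 where $z_k=x_1+\cdots+x_k$, $f^{(r)}$ is the $r$-th derivative, and $n\wedge k=\min\{n,k\}$. *)

(* Defs.v *)
From HB Require Import structures.
From mathcomp Require Import all_boot all_order all_algebra.
From mathcomp Require Import all_classical all_reals all_analysis.
Set Implicit Arguments. Unset Strict Implicit. Unset Printing Implicit Defensive.
Import Order.TTheory GRing.Theory Num.Theory.
Import numFieldNormedType.Exports.
Local Open Scope classical_set_scope.
Local Open Scope ring_scope.

(* Processes are families X : R -> T -> R of which only the values at times
   t >= 0 are meaningful: every definition below ignores X t for t < 0.
   Properties of the paths are required of all paths, distributional properties
   refer to P. *)

Section Processes.
Context {R : realType} {d : measure_display} {T : measurableType d}.
Variable P : probability T R.
Implicit Types X Y : R -> T -> R.

Definition independent_family n (Z : 'I_n -> T -> R) : Prop :=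
  forall A : 'I_n -> set R, (forall i, measurable (A i)) ->
    P (\bigcap_i (Z i @^-1` A i)) = (\prod_(i < n) P (Z i @^-1` A i))%E.

Definition independent_increments X : Prop :=
  forall n (t : nat -> R), 0 <= t 0%N -> {homo t : i j / (i <= j)%N >-> i <= j} ->
    independent_family (fun i : 'I_n => X (t i.+1) \- X (t i)).

Definition stationary_increments X : Prop :=
  forall s t, 0 <= s -> 0 <= t -> forall A : set R, measurable A ->
    P ((X (t + s) \- X t) @^-1` A) = P (X s @^-1` A).

Definition cadlag (x : R -> R) : Prop :=
  (forall t, 0 <= t -> x u @[u --> t^'+] --> x t) /\
  (forall t, 0 < t -> cvg (x u @[u --> t^'-])).

Record levy_process X : Prop := {
  levy_measurable : forall t, 0 <= t -> measurable_fun setT (X t) ;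
  levy_0 : forall w, X 0 w = 0 ;
  levy_independent : independent_increments X ;
  levy_stationary : stationary_increments X ;
  levy_cadlag : forall w, cadlag (X ^~ w) }.

Definition process_sigma_algebra X : set (set T) :=
  <<s [set E | exists t A, [/\ 0 <= t, measurable A & E = X t @^-1` A]] >>.

Definition independent_processes X Y : Prop :=
  forall E F, process_sigma_algebra X E -> process_sigma_algebra Y F ->
    (P (E `&` F) = P E * P F)%E.

End Processes.

(* Omega(k, n): the index j : 'I_k stands for j + 1 in {1, ..., k}, and every
   solution of \sum_j (j + 1) x_j = n has all its entries at most n. *)
Definition Omega (k n : nat) : {set {ffun 'I_k -> 'I_n.+1}} :=
  [set x : {ffun 'I_k -> 'I_n.+1} | (\sum_(j < k) j.+1 * x j)%N == n]%SET.

Definition total_rate {R : realType} k (lam : 'I_k -> R) : R := \sum_(j < k) lam j.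

Definition gcp_pmf {R : realType} k (lam : 'I_k -> R) (t : R) (n : nat) : R :=
  \sum_(x in Omega k n)
    (\prod_(j < k) ((lam j * t) ^+ x j / (x j)`!%:R)) * expR (- (total_rate lam * t)).

Record generalized_counting_process {R : realType} {d} {T : measurableType d}
    (P : probability T R) k (lam : 'I_k -> R) (M : R -> T -> nat) : Prop := {
  gcp_levy : levy_process P (fun t w => (M t w)%:R) ;
  gcp_law : forall t n, 0 <= t ->
    P [set w | M t w = n] = (gcp_pmf lam t n)%:E }.

Definition levy_measure {R : realType}
    (nu : {measure set (measurableTypeR R) -> \bar R}) : Prop :=
  (\int[nu]_(x in `]0%R, +oo[) (Num.min x 1)%:E < +oo)%E.

Definition bernstein {R : realType} (c2 : R)
    (nu : {measure set (measurableTypeR R) -> \bar R}) (s : R) : R :=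
  c2 * s + \int[nu]_(x in `]0, +oo[) (1 - expR (- (s * x))).

Record levy_subordinator {R : realType} {d} {T : measurableType d}
    (P : probability T R) (f : R -> R) (D : R -> T -> R) : Prop := {
  subordinator_levy : levy_process P D ;
  subordinator_nondecreasing :
    forall w s t, 0 <= s -> s <= t -> D s w <= D t w ;
  subordinator_laplace : forall s t, 0 <= s -> 0 <= t ->
    ('E_P[fun w => expR (- (s * D t w))] = (expR (- (t * f s)))%:E)%E }.

Definition time_changed {R : realType} {T : Type} (M : R -> T -> nat)
    (D : R -> T -> R) : R -> T -> nat :=
  fun t w => M (D t w) w.

(* The infimum of the empty set is +oo: the level n may never be reached, e.g.
   when f = 0. *)
Definition first_passage {R : realType} {T : Type} (N : R -> T -> nat) (n : nat)
    (w : T) : \bar R :=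
  ereal_inf [set s%:E | s in [set s : R | 0 <= s /\ (n <= N s w)%N]].

(* Derivative of g at t as a function on [0, +oo[: the usual derivative for
   t > 0 (derive_on_halflineP) and the right derivative for t = 0. *)
Definition is_derive_on_halfline {R : realType} (g : R -> R) (t l : R) : Prop :=
  h^-1 * (g (t + h) - g t) @[h --> within [set h | 0 <= t + h] (0 : R)^'] --> l.

Definition derive_on_halfline {R : realType} (g : R -> R) (t : R) : R :=
  lim (h^-1 * (g (t + h) - g t) @[h --> within [set h | 0 <= t + h] (0 : R)^']).

Definition passage_density {R : realType} {d} {T : measurableType d}
    (P : probability T R) (N : R -> T -> nat) (n : nat) (s : R) : R :=
  if n == 0%N then 0
  else derive_on_halfline (fun u => fine (P [set w | (n <= N u w)%N])) s.

(* The operator f(Lambda I - \sum_(j <= n /\ k) lam_j B^j) applied to the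
   sequence of functions p, at (n, t). *)
Definition bernstein_shift_op {R : realType} (f : R -> R) k (lam : 'I_k -> R)
    (p : nat -> R -> R) (n : nat) (t : R) : R :=
  f (total_rate lam) * p n t +
  \sum_(1 <= m < n.+1) \sum_(x in Omega k m)
     derive1n (\sum_(j < k) x j)%N f (total_rate lam) *
     (\prod_(j < k) ((- lam j) ^+ x j / (x j)`!%:R)) * p (n - m)%N t.

Lemma within_halfline_gt0 {R : realType} (t : R) : 0 < t ->
  within [set h : R | 0 <= t + h] (0 : R)^' = (0 : R)^'.
Proof.
move=> t0; apply/seteqP; split => A; last first.
  by rewrite /within /=; apply: filterS.
have H : \forall h \near (0 : R)^', 0 <= t + h.
  apply: (@cvg_within _ (nbhs (0 : R))).
  exists t => //= h /=; rewrite sub0r normrN => ht.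
  by rewrite -lerBlDl sub0r; apply: ltW; move: ht; rewrite ltr_norml => /andP[].
by rewrite /within /= => HA; apply: filterS2 H HA => h h0; apply.
Qed.

Lemma derive_on_halflineP {R : realType} (g : R -> R) (t l : R) : 0 < t ->
  is_derive_on_halfline g t l <-> is_derive t 1 g l.
Proof.
move=> t0; rewrite /is_derive_on_halfline within_halfline_gt0//.
have E : (fun h => h^-1 * (g (t + h) - g t)) =
         (fun h => h^-1 *: ((g \o shift t) (h *: 1) - g t)).
  by apply/funext => h /=; rewrite /= [h *: 1]mulr1 (addrC h).
rewrite E; split => [gl|[dg <-]]; last exact: dg.
split; first by apply/cvg_ex; exists l.
exact: cvg_lim.
Qed.

(* Main.v *)
Require Import Defs.
From HB Require Import structures.
From mathcomp Require Import all_boot all_order all_algebra.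
From mathcomp Require Import all_classical all_reals all_analysis.
From mathcomp Require Import measurable_realfun.
From mathcomp Require Import ring zify.
Set Implicit Arguments.
Unset Strict Implicit.
Unset Printing Implicit Defensive.
Import Order.TTheory GRing.Theory Num.Theory.
Import numFieldNormedType.Exports.
Local Open Scope classical_set_scope.
Local Open Scope ring_scope.

(** Write [*] for the Cauchy product of sequences, [u] for a formal variable,
    [Lambda] for the total rate and [g(u)] for the polynomial
    [Lambda - sum_j lam_j u^j]. Conditionally on [D t = x], the generating function
    of the subordinated process at time [t] is [exp(- x g(u))]; averaging over
    the law of [D t], whose Laplace transform is [exp(- t f)], gives
    [exp(- t f(g(u)))]. So the state probabilities [Q_m(t)] are the
    coefficients of [exp(- t F(u))], where the coefficients [F_m] of
    [F(u) = f(g(u))] are exactly those of the shift operator [f(g(B))], and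
    [Q' = - F * Q]. The tail [P(n <= N(t))] is [1 - sum_(m < n) Q_m(t)], hence
    the density is [p_n = sum_(m < n) (F * Q)_m]. Taking partial sums commutes
    with convolution by [F], so the same linear equation [p' = - F * p] holds
    for the densities, and that is the system to be proved.

    No power series in [u] is formed. Composition with [g] is the linear map
    that sends the Taylor coefficients of a function at [Lambda] to a sum over
    [Omega], and by the multinomial theorem it turns Cauchy products of Taylor
    coefficients into Cauchy products of sequences ([omega_sum_seqconv]). It
    remains to differentiate in [t] the Taylor coefficients at [Lambda] of
    [exp(- t f)]: they obey a recursion which follows from
    [(exp(- t f))' = - t f' exp(- t f)], and differentiating this recursion
    gives the equation by induction ([exp_family_derive]). All derivatives
    exist since [f] is minus the logarithm of the Laplace transform of [D 1],
    which can be differentiated under the expectation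
    ([laplace_exponent_smooth]); the derivatives of [exp(- t f)] are then, up
    to sign, the moments [E((D t)^z exp(- s D t))] that appear when the mass
    function of the counting process is averaged ([expectation_gcp_pmf]).

    On the probabilistic side, the law of [M (D t)] is this average because
    [D t] can be approximated strictly from the right by grid-valued times,
    for which independence applies cell by cell, while the paths of [M] are
    locally constant to the right ([probability_mixture]). The first passage
    time is at most [s] as soon as [n <= N s]; the converse holds off a null
    set, since a process with nonnegative values and stationary increments is
    almost surely nondecreasing ([probability_first_passage]). *)

(** * Cauchy products of sequences *)

Section Convolution.
Context {R : comNzRingType}.
Implicit Types (a b c : nat -> R) (z N : nat).

Definition seqconv a b z : R := \sum_(i < z.+1) a i * b (z - i)%N.

Lemma seqconv_coef N a b z : (z < N)%N ->
  seqconv a b z = ((\poly_(i < N) a i) * \poly_(i < N) b i)`_z.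
Proof.
move=> zN; rewrite coefM; apply: eq_bigr => i _; rewrite !coef_poly.
by rewrite (leq_ltn_trans (leq_subr _ _) zN) (leq_trans (ltn_ord i) zN).
Qed.

Lemma eq_seqconv a a' b b' z : (forall i, (i <= z)%N -> a i = a' i) ->
  (forall i, (i <= z)%N -> b i = b' i) -> seqconv a b z = seqconv a' b' z.
Proof.
move=> aa bb; apply: eq_bigr => i _; rewrite aa ?bb ?leq_subr//.
by rewrite -ltnS.
Qed.

Lemma seqconvC a b z : seqconv a b z = seqconv b a z.
Proof. by rewrite !(seqconv_coef _ _ (ltnSn z)) mulrC. Qed.

Lemma seqconvA a b c z : seqconv a (seqconv b c) z = seqconv (seqconv a b) c z.
Proof.
have zz := ltnSn z.
pose p x := \poly_(i < z.+1) (x i : R).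
have E u v i : (i <= z)%N -> (p (seqconv u v))`_i = (p u * p v)`_i.
  by move=> iz; rewrite coef_poly ltnS iz (seqconv_coef (N := z.+1)).
rewrite !(seqconv_coef _ _ zz).
transitivity ((p a * (p b * p c))`_z).
  by rewrite !(coefM (p a)); apply: eq_bigr => i _; rewrite E ?leq_subr.
rewrite mulrA (coefM (p a * p b)) (coefM (p (seqconv a b))).
by apply: eq_bigr => i _; rewrite E// -ltnS.
Qed.

Lemma seqconvCA a b c z : seqconv a (seqconv b c) z = seqconv b (seqconv a c) z.
Proof. by rewrite !seqconvA; apply: eq_seqconv => // i _; exact: seqconvC. Qed.

(** Coefficients of the derivative of the series with coefficients [a]. *)
Definition seqderiv a i : R := i.+1%:R * a i.+1.

Lemma seqderiv_seqconv a b z :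
  seqderiv (seqconv a b) z =
  seqconv (seqderiv a) b z + seqconv a (seqderiv b) z.
Proof.
pose p N x := \poly_(i < N) (x i : R).
have E u N i : (i < N)%N -> ((p N.+1 u)^`())`_i = (p N (seqderiv u))`_i.
  by move=> iN; rewrite coef_deriv !coef_poly ltnS iN -mulr_natl.
have -> : seqderiv (seqconv a b) z = ((p z.+2 a * p z.+2 b)^`())`_z.
  by rewrite coef_deriv -mulr_natl /seqderiv (seqconv_coef (N := z.+2)).
rewrite derivM coefD !coefM; congr (_ + _).
  apply: eq_bigr => i _; rewrite E// !coef_poly ltn_ord.
  by rewrite ltnS (leq_trans (leq_subr _ _)).
apply: eq_bigr => i _; rewrite E ?ltnS ?leq_subr// !coef_poly.
by rewrite !ltnS leq_subr (ltnW (ltn_ord i)).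
Qed.

(** Partial sums are the Cauchy product with the coefficients of [u / (1 - u)];
    the products associate and commute. *)
Lemma sum_seqconv a b n :
  \sum_(m < n) seqconv a b m = seqconv a (fun j => \sum_(l < j) b l) n.
Proof.
have S c j : \sum_(l < j) c l = seqconv (fun i => (0 < i)%:R) c j.
  rewrite /seqconv big_ord_recl/= mul0r add0r [LHS](reindex_inj rev_ord_inj)/=.
  by apply: eq_bigr => i _; rewrite mul1r.
rewrite S seqconvCA; apply: eq_seqconv => // i _; apply: eq_seqconv => // j _.
Qed.

Lemma seqconvZr k a b z : seqconv a (fun i => k * b i) z = k * seqconv a b z.
Proof.
by rewrite /seqconv mulr_sumr; apply: eq_bigr => i _; rewrite mulrCA.
Qed.

Lemma seqconvNr a b z : seqconv a (fun i => - b i) z = - seqconv a b z.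
Proof. by rewrite /seqconv -sumrN; apply: eq_bigr => i _; rewrite mulrN. Qed.

End Convolution.

(** * Composition with the shift polynomial *)

Section Multinomial.
Context {F : numFieldType}.
Implicit Types (A : {poly F}).

(** Exponential of [A Y] truncated at order [N], where [Y] is the outer variable:
    it records the exponent of [A], i.e. the order of the derivative of [f]. *)
Definition exp_poly N A : {poly {poly F}} :=
  \poly_(i < N) ((i`!%:R^-1)%:P * A ^+ i).

(** The binomial theorem, read as [exp(A Y) exp(B Y) = exp((A + B) Y)]. *)
Lemma coef_exp_polyD N A B z : (z < N)%N ->
  (exp_poly N A * exp_poly N B)`_z = (exp_poly N (A + B))`_z.
Proof.
move=> zN; rewrite -(seqconv_coef _ _ zN) coef_poly zN addrC exprDn mulr_sumr.
apply: eq_bigr => i _; have iz : (i <= z)%N by rewrite -ltnS.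
rewrite mulrACA (mulrC (A ^+ i)) -polyCM mulrnAr -mulrnAl -polyCMn.
congr (_%:P * _); rewrite -(bin_fact iz) !natrM !invfM -[RHS]mulr_natr.
have Cn : ('C(z, i))%:R != 0 :> F by rewrite pnatr_eq0 -lt0n bin_gt0.
by rewrite [RHS]mulrC mulVKf.
Qed.

Lemma coef_prod_exp_poly N (I : Type) (r : seq I) (A : I -> {poly F}) z :
  (z < N)%N ->
  (\prod_(j <- r) exp_poly N (A j))`_z = (exp_poly N (\sum_(j <- r) A j))`_z.
Proof.
elim: r z => [|j r IH] z zN.
  rewrite !big_nil coef1 coef_poly zN; case: z {zN} => [|z].
    by rewrite mulr1 fact0 invr1.
  by rewrite expr0n mulr0.
rewrite !big_cons -coef_exp_polyD// !coefM; apply: eq_bigr => i _.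
by rewrite IH// (leq_ltn_trans (leq_subr _ _)).
Qed.

Variables (k : nat) (lam : 'I_k -> F).

(** The difference between [Lambda - sum_j lam_j u^j] and its value at [u = 0]. *)
Definition shift_poly : {poly F} := \sum_(j < k) (- lam j) *: 'X^(j.+1).

Definition omega_weight n (x : {ffun 'I_k -> 'I_n}) : F :=
  \prod_(j < k) ((- lam j) ^+ x j / (x j)`!%:R).

Definition omega_deg n (x : {ffun 'I_k -> 'I_n}) : nat := (\sum_(j < k) x j)%N.

Definition omega_sum m (a : nat -> F) : F :=
  \sum_(x in Omega k m) a (omega_deg x) * omega_weight x.

(** The multinomial theorem. Expanding the product over [j] of the truncated
    exponentials of [- lam_j u^(j+1) Y] gives all [x] with entries at most [m];
    the power of [Y] is the degree of [x] and the power of [u] is the weighted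
    sum that defines [Omega]. *)
Lemma coef_shift_polyX z m :
  (z <= m)%N -> (z`!%:R^-1 *: shift_poly ^+ z)`_m =
  \sum_(x in Omega k m | omega_deg x == z) omega_weight x.
Proof.
move=> zm; have zm1 : (z < m.+1)%N by [].
transitivity ((\prod_(j < k) exp_poly m.+1 ((- lam j) *: 'X^(j.+1)))`_z)`_m.
  by rewrite coef_prod_exp_poly// coef_poly zm1 mul_polyC.
under eq_bigr do rewrite /exp_poly poly_def.
rewrite bigA_distr_bigA/= !coef_sum [RHS]big_mkcond [RHS]big_mkcond/=.
apply: eq_bigr => x _.
rewrite scaler_prod prodrXr coefZ coefXn.
have -> : \prod_(j < k) ((x j)`!%:R^-1%:P * ((- lam j) *: 'X^(j.+1)) ^+ x j)
    = omega_weight x *: 'X^(\sum_(j < k) j.+1 * x j).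
  rewrite -prodrXr/= /omega_weight -scaler_prod; apply: eq_bigr => j _.
  by rewrite exprZn -exprM mul_polyC scalerA mulrC.
rewrite inE /omega_deg (eq_sym z); case: eqP => _; last first.
  by rewrite andbF mulr0 coef0.
by rewrite andbT mulr1 coefZ coefXn eq_sym; case: eqP => _;
  rewrite ?mulr1 ?mulr0.
Qed.

Lemma omega_deg_le m (x : {ffun 'I_k -> 'I_m.+1}) :
  x \in Omega k m -> (omega_deg x <= m)%N.
Proof.
rewrite inE => /eqP E; rewrite -[leqRHS]E.
by apply: leq_sum => j _; exact: leq_pmull.
Qed.

(** If [a] lists Taylor coefficients at [Lambda], the sum over [Omega k m] is the
    [m]-th coefficient of the composite with [Lambda - sum_j lam_j u^j]. Any
    truncation order above [m] will do, as the shift polynomial has no constant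
    term. *)
Lemma omega_sumE N m (a : nat -> F) : (m < N)%N ->
  omega_sum m (fun z => z`!%:R * a z) =
  ((\poly_(z < N) a z) \Po shift_poly)`_m.
Proof.
move=> mN.
have lowX z : (m < z)%N -> (shift_poly ^+ z)`_m = 0.
  move=> mz.
  have [q ->] : exists q, shift_poly = 'X * q.
    exists (\sum_(j < k) (- lam j) *: 'X^j); rewrite mulr_sumr.
    by apply: eq_bigr => j _; rewrite -scalerAr exprS.
  by rewrite exprMn coefXnM mz.
rewrite poly_def linear_sum/= coef_sum.
transitivity (\sum_(z < m.+1) z`!%:R * a z * (z`!%:R^-1 *: shift_poly ^+ z)`_m).
  under eq_bigr => z _.
    rewrite (coef_shift_polyX (ltn_ord z : z <= m)%N) mulr_sumr; over.
  rewrite (exchange_big_dep (fun x => x \in Omega k m))/=; last first.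
    by move=> z x _ /andP[].
  apply: eq_bigr => x xO.
  rewrite (big_pred1 (Ordinal (omega_deg_le xO : omega_deg x < m.+1)%N))// => z.
  by rewrite xO/= -(inj_eq val_inj)/= eq_sym.
rewrite (big_ord_widen N
  (fun z => z`!%:R * a z * (z`!%:R^-1 *: shift_poly ^+ z)`_m))//.
rewrite big_mkcond/=; apply: eq_bigr => z _.
rewrite comp_polyZ comp_Xn_poly [in RHS]coefZ.
case: ifPn => [_|]; last by rewrite -ltnNge => /lowX ->; rewrite mulr0.
by rewrite coefZ mulrA [_ * a z]mulrC mulfK// pnatr_eq0 -lt0n fact_gt0.
Qed.

(** Composition is multiplicative. *)
Lemma omega_sum_seqconv m (a b : nat -> F) :
  omega_sum m (fun z => z`!%:R * seqconv a b z) =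
  seqconv (fun i => omega_sum i (fun z => z`!%:R * a z))
       (fun i => omega_sum i (fun z => z`!%:R * b z)) m.
Proof.
have mm := ltnSn m.
pose p x := \poly_(i < m.+1) (x i : F).
transitivity (((p a * p b) \Po shift_poly)`_m).
  (* High enough an order for the product of the truncations not to be truncated
     again. *)
  pose N := maxn m.+1 (size (p a * p b)).
  have -> : p a * p b = \poly_(z < N) (p a * p b)`_z.
    by apply/polyP => i; rewrite coef_poly; case: ltnP => // Ni;
      rewrite nth_default// (leq_trans _ Ni)// leq_maxr.
  rewrite -omega_sumE ?leq_maxl//; apply: eq_bigr => x xO.
  by rewrite (seqconv_coef _ _ (omega_deg_le xO : omega_deg x < m.+1)%N).
rewrite comp_polyM coefM; apply: eq_bigr => i _.
by rewrite -!omega_sumE// ?ltnS// leq_subr.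
Qed.

End Multinomial.

(** * Taylor coefficients on the positive half-line *)

Section Towers.
Context {R : realType}.
Implicit Types (f g : R -> R) (a b : nat -> R -> R).

Lemma is_derive1_sum (I : Type) (r : seq I) (Q : pred I) (h : I -> R -> R)
    (dh : I -> R) (x : R) :
  (forall i, is_derive x 1 (h i) (dh i)) ->
  is_derive x 1 (fun y => \sum_(i <- r | Q i) h i y) (\sum_(i <- r | Q i) dh i).
Proof.
move=> H; elim: r => [|i r IH].
  rewrite big_nil (_ : (fun _ => _) = cst 0); first exact: is_derive_cst.
  by apply/funext => y; rewrite big_nil.
rewrite big_cons; under eq_fun do rewrite big_cons.
by case: (Q i) => //; exact: is_deriveD.
Qed.

Lemma is_derive1M f g (x df dg : R) :
  is_derive x 1 f df -> is_derive x 1 g dg ->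
  is_derive x 1 (fun y => f y * g y) (df * g x + f x * dg).
Proof.
move=> Hf Hg; have := is_deriveM Hf Hg.
by rewrite [_ + _]addrC [g x *: _]mulrC.
Qed.

Lemma is_derive1Ml (c : R) f (x df : R) : is_derive x 1 f df ->
  is_derive x 1 (fun y => c * f y) (c * df).
Proof. by move=> Hf; exact: is_deriveZ. Qed.

Lemma is_derive1_eq f g (x df dg : R) : (forall y, f y = g y) -> df = dg ->
  is_derive x 1 f df -> is_derive x 1 g dg.
Proof. by move=> /funext -> ->. Qed.

Lemma pos_eq_is_derive f g (s df : R) : 0 < s ->
  (forall u, 0 < u -> f u = g u) -> is_derive s 1 f df -> is_derive s 1 g df.
Proof.
move=> s0 fg; apply: near_eq_is_derive => //.
near=> u; apply: fg; near: u; exact: lt_nbhsr.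
Unshelve. all: by end_near. Qed.

(** The behaviour of the Taylor coefficients [a i s] of a function at a moving
    point [s]. With the factorials absorbed, the Leibniz rule is a Cauchy product
    without binomial coefficients. *)
Definition tower a := forall i (s : R), 0 < s ->
  is_derive s 1 (a i) (seqderiv (a ^~ s) i).

Lemma tower_unique a b : tower a -> tower b ->
  (forall s, 0 < s -> a 0%N s = b 0%N s) ->
  forall i s, 0 < s -> a i s = b i s.
Proof.
move=> ta tb ab0; elim=> [//|i IH] s s0.
have := pos_eq_is_derive s0 IH (ta i s s0).
have := tb i s s0 => -[_ E1] [_]; rewrite E1 => /mulfI ->//.
Qed.

Lemma tower_seqconv a b : tower a -> tower b ->
  tower (fun z s => seqconv (a ^~ s) (b ^~ s) z).
Proof.
move=> ta tb z s s0.
rewrite seqderiv_seqconv /seqconv -big_split/=.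
apply: is_derive1_sum => i; apply: is_derive1M; [exact: ta|exact: tb].
Qed.

Lemma tower_seqderiv a : tower a -> tower (fun z s => seqderiv (a ^~ s) z).
Proof. by move=> ta z s s0; apply: is_derive1Ml; exact: ta. Qed.

Lemma tower_scale c a : tower a -> tower (fun z s => c * a z s).
Proof.
move=> ta z s s0; rewrite /seqderiv mulrCA; apply: is_derive1Ml; exact: ta.
Qed.

Definition smooth_pos g :=
  forall i (s : R), 0 < s -> derivable (derive1n i g) s 1.

Definition taylor g i (s : R) : R := i`!%:R^-1 * derive1n i g s.

Lemma fact_taylor g i s : i`!%:R * taylor g i s = derive1n i g s.
Proof. by rewrite mulVKf// pnatr_eq0 -lt0n fact_gt0. Qed.

Lemma taylor_tower g : smooth_pos g -> tower (taylor g).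
Proof.
move=> sg i s s0; apply: (@is_derive1_eq (fun y => i`!%:R^-1 * derive1n i g y)
  _ _ (i`!%:R^-1 * derive1n i.+1 g s)) => //.
  rewrite /seqderiv /taylor factS natrM invfM !mulrA mulfV ?mul1r ?pnatr_eq0//.
apply: is_derive1Ml; rewrite derive1nS derive1E; apply: derivableP; exact: sg.
Qed.

(** A class of functions closed under differentiation has smooth members: this
    avoids computing the iterated derivatives. *)
Lemma closed_smooth (S : (R -> R) -> Prop) :
  (forall g, S g ->
     exists2 g', S g' & forall s : R, 0 < s -> is_derive s 1 g (g' s)) ->
  forall g, S g -> smooth_pos g.
Proof.
move=> HS g Sg.
suff H i : exists2 h, S h & forall s, 0 < s -> derive1n i g s = h s.
  move=> i s s0; have [h Sh hE] := H i.
  have [h' _ /(_ s s0) h'E] := HS _ Sh.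
  apply: ex_derive; apply: pos_eq_is_derive h'E => // u u0.
  by rewrite hE.
elim: i => [|i [h Sh hE]]; first by exists g.
have [h' Sh' h'E] := HS _ Sh; exists h' => // s s0.
rewrite derive1nS derive1E.
by apply: derive_val; apply: pos_eq_is_derive (h'E s s0) => // u u0; rewrite hE.
Qed.

(** [(exp(- t f))' = - t f' exp(- t f)] in Taylor coefficients. Both sides are
    towers, so it suffices to compare their first terms. *)
Lemma taylor_exp (f : R -> R) t z s : smooth_pos f ->
  smooth_pos (fun u => expR (- (t * f u))) -> 0 < s ->
  seqderiv (taylor (fun u => expR (- (t * f u))) ^~ s) z =
  - t * seqconv (seqderiv (taylor f ^~ s))
                (taylor (fun u => expR (- (t * f u))) ^~ s) z.
Proof.
move=> sf se s0.
apply: (tower_unique (tower_seqderiv (taylor_tower se))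
  (tower_scale (- t)
    (tower_seqconv (tower_seqderiv (taylor_tower sf)) (taylor_tower se))))
  => // u u0.
rewrite /seqconv big_ord_recl big_ord0 addr0 /seqderiv !mul1r subn0.
rewrite /taylor !fact0 !factS !fact0 !muln1 !invr1 !mul1r.
rewrite !derive1nS !derive1n0 !derive1E.
apply: derive_val.
have df : is_derive u 1 f ('D_1 f u) by apply: derivableP; exact: (sf 0%N).
have dt := is_derive1Ml (- t) df.
have := @is_derive1_comp _ expR _ _ _ _ (is_derive_expR _) dt.
by apply: is_derive1_eq => [y|]; rewrite /= ?mulNr// mulrN mulrC mulrA.
Qed.

(** Formally, [eta t = exp(- t phi)], whose derivative in [t] is
    [- phi exp(- t phi)]. The second hypothesis determines [eta t] from its first
    term; differentiating it in [t] and using the induction hypothesis leaves the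
    Leibniz rule for the product of [phi] and [eta t]. *)
Lemma exp_family_derive (phi : nat -> R) (eta : R -> nat -> R) :
  (forall t, eta t 0%N = expR (- (t * phi 0%N))) ->
  (forall t z, seqderiv (eta t) z = - t * seqconv (seqderiv phi) (eta t) z) ->
  forall z (t : R), is_derive t 1 (eta ^~ z) (- seqconv phi (eta t) z).
Proof.
move=> eta0 etaS z; have [n] := ubnP z; elim: n z => // n IH [|z] zn t.
  rewrite /seqconv big_ord_recl big_ord0 addr0 subn0.
  have dl := is_derive1Ml (- phi 0%N) (is_derive_id t 1).
  have := @is_derive1_comp _ expR _ t _ _ (is_derive_expR _) dl.
  apply: is_derive1_eq => [y|]; rewrite ?eta0/=.
    by rewrite mulNr mulrC.
  by rewrite mulr1 !mulNr mulrN mulrC (mulrC t).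
have z1 : z.+1%:R != 0 :> R by rewrite pnatr_eq0.
(* The recursion of index z, differentiated in t. *)
have -> : - seqconv phi (eta t) z.+1 = z.+1%:R^-1 *
    (- 1 * seqconv (seqderiv phi) (eta t) z +
     - t * seqconv (seqderiv phi) (fun i => - seqconv phi (eta t) i) z).
  apply: (mulfI z1); rewrite mulVKf// mulrN -/(seqderiv _ _) seqderiv_seqconv.
  rewrite [seqconv phi (seqderiv _) z](eq_seqconv (a' := phi)
    (b' := fun i => - t * seqconv (seqderiv phi) (eta t) i))//.
  by rewrite seqconvZr seqconvCA seqconvNr; ring.
apply: (@is_derive1_eq
  (fun u => z.+1%:R^-1 * (- u * seqconv (seqderiv phi) (eta u) z))) => //.
  by move=> u; rewrite -etaS /seqderiv mulKf.
apply: is_derive1Ml.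
apply: (@is_derive1M (fun u => - u) (fun u => seqconv (seqderiv phi) (eta u) z)).
apply: is_derive1_sum => i; apply: is_derive1Ml.
by apply: IH; rewrite (leq_ltn_trans (leq_subr _ _)).
Qed.

End Towers.

(** * Derivatives of Laplace transforms *)

Section Laplace.
Context {R : realType} {d : measure_display} {T : measurableType d}.
Variable P : probability T R.

(** One term of the exponential series of [s x]. *)
Lemma pow_expR_le (z : nat) (s x : R) : 0 < s -> 0 <= x ->
  x ^+ z * expR (- (s * x)) <= z`!%:R / s ^+ z.
Proof.
move=> s0 x0; have sx0 : 0 <= s * x by rewrite mulr_ge0// ltW.
have H : (s * x) ^+ z / z`!%:R <= expR (s * x).
  case: z => [|z]; first by rewrite expr0 fact0 divr1 -expR0 ler_expR.
  by apply: le_trans (expR_ge1Dxn z sx0); rewrite lerDr.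
rewrite expRN ler_pdivrMr ?expR_gt0// mulrAC ler_pdivlMr ?exprn_gt0//.
by rewrite -ler_pdivrMl ?ltr0n ?fact_gt0// mulrC -exprMn (mulrC x).
Qed.

Variable X : T -> R.
Hypothesis mX : measurable_fun setT X.
Hypothesis X0 : forall w, 0 <= X w.

Definition laplace_moment (z : nat) (s : R) : R :=
  \int[P]_w (X w ^+ z * expR (- (s * X w))).

Lemma measurable_pow_expR z s :
  measurable_fun setT (fun w => X w ^+ z * expR (- (s * X w))).
Proof.
apply: measurable_funM; first exact: measurable_funX.
apply: (measurableT_comp (@measurable_expR R)).
by apply: measurable_funN; exact: measurable_funM.
Qed.

Lemma integrable_pow_expR z s : 0 < s ->
  P.-integrable setT (EFin \o fun w => X w ^+ z * expR (- (s * X w))).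
Proof.
move=> s0; apply: measurable_bounded_integrable => //.
- by rewrite (le_lt_trans (probability_le1 _ _))// ltry.
- exact: measurable_pow_expR.
- exists (z`!%:R / s ^+ z); split; first exact: num_real.
  move=> M sM w _ /=; rewrite ger0_norm ?mulr_ge0 ?expR_ge0 ?exprn_ge0//.
  exact: le_trans (pow_expR_le _ _ _) (ltW sM).
Qed.

Lemma laplace_moment_derive z (s : R) : 0 < s ->
  is_derive s 1 (laplace_moment z) (- laplace_moment z.+1 s).
Proof.
move=> s0.
pose f (x : R) w := X w ^+ z * expR (- (x * X w)).
have df (x : R) w :
    is_derive x 1 (f ^~ w) (- (X w ^+ z.+1 * expR (- (x * X w)))).
  have := @is_derive1_comp _ expR _ x _ _ (is_derive_expR _)
    (is_derive1Ml (- X w) (is_derive_id x 1)).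
  move/(is_derive1Ml (X w ^+ z)); apply: is_derive1_eq => [y|] /=.
    by rewrite /f mulNr (mulrC y).
  by rewrite mulr1 !mulrN exprS mulNr (mulrC (X w) x); ring.
(* On the interval from s / 2 to 2 s the derivative of the integrand is dominated
   by the bound for s / 2, a constant. *)
have h0 : 0 < s / 2 by rewrite divr_gt0.
have Is : `](s / 2), (s * 2)[%classic s.
  by rewrite /= in_itv/= ltr_pdivrMr// ltr_pMr// ltr1n.
have I0 x : `](s / 2), (s * 2)[%classic x -> 0 < x.
  by rewrite /= in_itv/= => /andP[+ _]; exact: lt_trans.
have d1 x w : partial1of2 f x w = - (X w ^+ z.+1 * expR (- (x * X w))).
  by rewrite partial1of2E; apply: derive_val.
have G0 (w : T) : 0 <= z.+1`!%:R / (s / 2) ^+ z.+1.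
  by rewrite divr_ge0// exprn_ge0// ltW.
have intf x : `](s / 2), (s * 2)[%classic x -> P.-integrable setT (EFin \o f x).
  by move=> /I0 x0; exact: integrable_pow_expR.
have der x w : `](s / 2), (s * 2)[%classic x -> setT w ->
    derivable (f ^~ w) x 1.
  by move=> _ _; apply: ex_derive; exact: df.
have intG : P.-integrable setT
    (EFin \o fun _ : T => z.+1`!%:R / (s / 2) ^+ z.+1).
  exact: finite_measure_integrable_cst.
have Gub x w : `](s / 2), (s * 2)[%classic x -> setT w ->
    `|partial1of2 f x w| <= z.+1`!%:R / (s / 2) ^+ z.+1.
  move=> + _; rewrite /= in_itv/= => /andP[sx _].
  rewrite d1 normrN ger0_norm ?mulr_ge0 ?expR_ge0 ?exprn_ge0//.
  apply: le_trans (pow_expR_le _ h0 (X0 w)).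
  by rewrite ler_wpM2l ?exprn_ge0// ler_expR lerN2 ler_wpM2r// ltW.
have E : \int[P]_(y in setT) partial1of2 f s y = - laplace_moment z.+1 s.
  under eq_Rintegral do rewrite d1 -mulN1r.
  by rewrite RintegralZl ?mulN1r//; exact: integrable_pow_expR.
apply: DeriveDef.
  exact: (@derivable_under_integral R _ _ P f setT measurableT s _ _ Is
    intf der _ G0 intG Gub).
rewrite -derive1E -E.
exact: (@differentiation_under_integral R _ _ P f setT measurableT s _ _ Is
  intf der _ G0 intG Gub).
Qed.

End Laplace.

(** * Smoothness of the Laplace exponent *)

Section Smoothness.
Context {R : realType}.
Variables (L : nat -> R -> R) (f : R -> R).
Hypothesis dL : forall z (s : R), 0 < s -> is_derive s 1 (L z) (- L z.+1 s).
Hypothesis L0E : forall s : R, 0 < s -> L 0%N s = expR (- f s).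

(** A class closed under differentiation that contains [f'] and the functions
    [exp(c f)]; the quotient [f' = L 1 / L 0] is in it because [1 / L 0 = exp f]. *)
Inductive moment_class : (R -> R) -> Prop :=
| moment_class_L z : moment_class (L z)
| moment_class_exp c : moment_class (fun s => expR (c * f s))
| moment_class_cst c : moment_class (fun=> c)
| moment_class_add g h :
    moment_class g -> moment_class h -> moment_class (fun s => g s + h s)
| moment_class_mul g h :
    moment_class g -> moment_class h -> moment_class (fun s => g s * h s).

(** [f = - ln (L 0)]. *)
Lemma exponent_derive (s : R) : 0 < s ->
  is_derive s 1 f (L 1%N s * expR (1 * f s)).
Proof.
move=> s0; have L0s : 0 < L 0%N s by rewrite L0E// expR_gt0.
apply: (@pos_eq_is_derive R (fun u => -1 * ln (L 0%N u))) => //.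
  by move=> u u0; rewrite L0E// expRK mulrN mulN1r opprK.
have := is_derive1Ml (-1)
  (@is_derive1_comp _ (@ln R) _ s _ _ (is_derive1_ln L0s) (dL 0 s0)).
apply: is_derive1_eq => //.
by rewrite mulrN mulN1r opprK L0E// -expRN opprK mulrC mul1r.
Qed.

Lemma moment_class_derive g : moment_class g ->
  exists2 g', moment_class g' & forall s : R, 0 < s -> is_derive s 1 g (g' s).
Proof.
elim=> [z|c|c|{}g h _ [g' Sg' Dg] _ [h' Sh' Dh]
        |{}g h Sg [g' Sg' Dg] Sh [h' Sh' Dh]].
- exists (fun s => (- 1) * L z.+1 s).
    exact: moment_class_mul (moment_class_cst _) (moment_class_L _).
  by move=> s s0; rewrite mulN1r; exact: dL.
- exists (fun s => expR (c * f s) * (c * (L 1%N s * expR (1 * f s)))).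
    apply: moment_class_mul (moment_class_exp c) _.
    apply: moment_class_mul (moment_class_cst c) _.
    exact: moment_class_mul (moment_class_L 1) (moment_class_exp 1).
  move=> s s0; apply: (@is_derive1_comp _ expR).
  exact: is_derive1Ml (exponent_derive s0).
- exists (fun=> 0); first exact: moment_class_cst.
  by move=> s _; exact: is_derive_cst.
- exists (fun s => g' s + h' s); first exact: moment_class_add.
  by move=> s s0; exact: is_deriveD (Dg s s0) (Dh s s0).
- exists (fun s => g' s * h s + g s * h' s).
    by apply: moment_class_add; exact: moment_class_mul.
  by move=> s s0; exact: is_derive1M (Dg s s0) (Dh s s0).
Qed.

Lemma smooth_exp_exponent c : smooth_pos (fun s => expR (c * f s)).
Proof. exact: closed_smooth moment_class_derive _ (moment_class_exp c). Qed.

Lemma smooth_exponent : smooth_pos f.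
Proof.
apply: (@closed_smooth R (fun g => g = f \/ moment_class g)); last by left.
move=> g [->|/moment_class_derive[g' Sg' Dg']]; last by exists g' => //; right.
exists (fun s => L 1%N s * expR (1 * f s)); last exact: exponent_derive.
right; exact: moment_class_mul (moment_class_L 1) (moment_class_exp 1).
Qed.

End Smoothness.

Section LaplaceExponent.
Context {R : realType} {d : measure_display} {T : measurableType d}.
Variables (P : probability T R) (D : R -> T -> R) (f : R -> R).
Hypothesis mD : forall t, 0 <= t -> measurable_fun setT (D t).
Hypothesis D0 : forall t w, 0 <= t -> 0 <= D t w.
Hypothesis laplaceD : forall s t, 0 <= s -> 0 <= t ->
  laplace_moment P (D t) 0 s = expR (- (t * f s)).

Definition exp_exponent t s := expR (- (t * f s)).

Lemma laplace_exponent_smooth : smooth_pos f.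
Proof.
apply: (@smooth_exponent R (laplace_moment P (D 1))).
  move=> z s s0; apply: laplace_moment_derive => //; first exact: mD.
  by move=> w; exact: D0.
by move=> s s0; rewrite laplaceD ?ltW// mul1r.
Qed.

Lemma exp_exponent_smooth t : smooth_pos (exp_exponent t).
Proof.
rewrite (_ : exp_exponent t = fun s => expR (- t * f s)); last first.
  by apply/funext => s; rewrite mulNr.
apply: (@smooth_exp_exponent R (laplace_moment P (D 1))).
  move=> z s s0; apply: laplace_moment_derive => //; first exact: mD.
  by move=> w; exact: D0.
by move=> s s0; rewrite laplaceD ?ltW// mul1r.
Qed.

(** Both sides are towers, up to factorials and signs, which start with the
    Laplace transform of [D t]. *)
Lemma laplace_momentE t z s : 0 <= t -> 0 < s ->
  laplace_moment P (D t) z s =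
  (-1) ^+ z * (z`!%:R * taylor (exp_exponent t) z s).
Proof.
move=> t0 s0.
have fz n : (n`!)%:R != 0 :> R by rewrite pnatr_eq0 -lt0n fact_gt0.
pose a n u := (-1) ^+ n / n`!%:R * laplace_moment P (D t) n u.
have ta : tower a.
  move=> n u u0.
  have := is_derive1Ml ((-1) ^+ n / n`!%:R)
    (laplace_moment_derive P (mD t0) (fun w => D0 w t0) n u0).
  apply: is_derive1_eq => //.
  have n1 : n.+1%:R != 0 :> R by rewrite pnatr_eq0.
  rewrite /seqderiv /a factS natrM exprS mulN1r invfM.
  by rewrite !mulNr !mulrN !mulrA (mulrC n.+1%:R) -!mulrA mulVKf.
rewrite -(tower_unique ta (taylor_tower (@exp_exponent_smooth t)) _ _ s0).
  by rewrite /a -!mulrA (mulrCA z`!%:R) mulVKf// mulrA -expr2 sqrr_sign mul1r.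
move=> u u0; rewrite /a /taylor expr0 fact0 invr1 !mul1r laplaceD// ltW//.
Qed.

End LaplaceExponent.

(** * Sampling a process at an independent random time *)

Section Mixture.
Context {R : realType} {d : measure_display} {T : measurableType d}.
Variables (P : probability T R) (M : R -> T -> nat) (X : T -> R) (m : nat).
Variable g : R -> R.
Hypothesis rcM :
  forall w (t : R), 0 <= t -> \forall u \near t^'+, M u w = M t w.
Hypothesis mM : forall t, 0 <= t -> measurable [set w | M t w = m].
Hypothesis pM : forall t, 0 <= t -> P [set w | M t w = m] = (g t)%:E.
Hypothesis mX : measurable_fun setT X.
Hypothesis X0 : forall w, 0 <= X w.
Hypothesis indMX : forall t A, 0 <= t -> measurable A ->
  P ([set w | M t w = m] `&` X @^-1` A) =
  (P [set w | M t w = m] * P (X @^-1` A))%E.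
Hypothesis cg : continuous g.

(** [XN N] is the right end of the cell of mesh [1 / (N + 1)] that contains [X].
    It exceeds [X], so that right limits of the paths of [M] apply. *)
Let grid N i : R := i.+1%:R / N.+1%:R.
Let XN N w : R := grid N (Num.truncn (N.+1%:R * X w)).
Let cell N i : set T := X @^-1` `[i%:R / N.+1%:R, i.+1%:R / N.+1%:R[%classic.

Let N0 N : 0 < N.+1%:R :> R. Proof. exact: ltr0Sn. Qed.

Let grid_ge0 N i : 0 <= grid N i.
Proof. by rewrite divr_ge0. Qed.

Let cellP N i w : cell N i w <-> Num.truncn (N.+1%:R * X w) = i.
Proof.
rewrite /cell /preimage/= in_itv/= ler_pdivrMr// ltr_pdivlMr// (mulrC (X w)).
have x0 : 0 <= N.+1%:R * X w by rewrite mulr_ge0.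
split=> [H|<-]; last exact: truncn_itv.
exact: truncn_def.
Qed.

Let XN_cell N i w : cell N i w -> XN N w = grid N i.
Proof. by move=> /cellP E; rewrite /XN E. Qed.

Let mcell N i : measurable (cell N i).
Proof. by rewrite -[cell _ _]setTI; apply: mX => //; exact: measurable_itv. Qed.

Let cell_triv N : trivIset setT (cell N).
Proof. by move=> i j _ _ [w [/cellP <- /cellP <-]]. Qed.

Let cell_cover N : \bigcup_i cell N i = setT.
Proof.
apply/seteqP; split => // w _; exists (Num.truncn (N.+1%:R * X w)) => //.
exact/cellP.
Qed.

Let XN_gt N w : X w < XN N w.
Proof.
have /andP[_] := truncn_itv (mulr_ge0 (ltW (N0 N)) (X0 w)).
by rewrite /XN /grid ltr_pdivlMr// mulrC.
Qed.

Let XN_le N w : XN N w <= X w + N.+1%:R^-1.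
Proof.
have /andP[+ _] := truncn_itv (mulr_ge0 (ltW (N0 N)) (X0 w)).
rewrite /XN /grid; set k := Num.truncn _ => kX.
by rewrite -(natr1 k) mulrDl div1r lerD2r ler_pdivrMr// mulrC.
Qed.

Let XN_cvg w : XN N w @[N --> \oo] --> (X w)^'+.
Proof.
move=> A [e /= e0 eA]; change (\forall N \near \oo, A (XN N w)).
near=> N; apply: eA; last exact: XN_gt.
rewrite /ball/= distrC gtr0_norm ?subr_gt0 ?XN_gt// ltrBlDl.
apply: le_lt_trans (XN_le _ _) _; rewrite ltrD2l.
near: N; exact: (near_infty_natSinv_lt (PosNum e0)).
Unshelve. all: by end_near. Qed.

Let EN N := [set w | M (XN N w) w = m].

Let ENE N : EN N = \bigcup_i (cell N i `&` [set w | M (grid N i) w = m]).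
Proof.
apply/seteqP; split => w /=.
  move=> Ew; have : (\bigcup_i cell N i) w by rewrite cell_cover.
  move=> [i _ ci]; exists i => //; split => //=.
  by rewrite -(XN_cell ci).
by move=> [i _ [ci] /=]; rewrite -(XN_cell ci).
Qed.

Let mEN N : measurable (EN N).
Proof.
rewrite ENE; apply: bigcupT_measurable => i; apply: measurableI => //.
exact: mM.
Qed.

Let g_ge0 t : 0 <= t -> 0 <= g t.
Proof. by move=> t0; rewrite -lee_fin -pM. Qed.

Let g_le1 t : 0 <= t -> g t <= 1.
Proof. by move=> t0; rewrite -lee_fin -pM// probability_le1//; exact: mM. Qed.

Let mgXN N : measurable_fun setT (fun w => (g (XN N w))%:E).
Proof.
rewrite -(cell_cover N); apply/(measurable_fun_bigcup _ (mcell N)) => i.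
apply: (@eq_measurable_fun _ _ _ _ _ (cst (g (grid N i))%:E)).
  by move=> w; rewrite inE => /XN_cell ->.
exact: measurable_cst.
Qed.

Let PEN N : P (EN N) = (\int[P]_w (g (XN N w))%:E)%E.
Proof.
rewrite ENE measure_bigcup//=; last 2 first.
- by move=> i _; apply: measurableI => //; exact: mM.
- by apply: trivIset_setIr; exact: cell_triv.
rewrite -(cell_cover N) ge0_integral_bigcup//; last 2 first.
- by rewrite cell_cover.
- by move=> w _; rewrite lee_fin g_ge0// grid_ge0.
rewrite eseries_mkcond; apply: eq_eseriesr => i _; rewrite mem_set//.
rewrite setIC indMX// pM//.
rewrite [RHS](eq_integral (cst (g (grid N i))%:E)); last first.
  by move=> w; rewrite inE => /XN_cell ->.
by rewrite integral_cst//=; exact: mcell.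
Qed.

Let E := [set w | M (X w) w = m].

Let EN_E w : \forall N \near \oo, M (XN N w) w = M (X w) w.
Proof. exact: (@XN_cvg w _ (rcM w (X0 w))). Qed.

Lemma measurable_mixture : measurable [set w | M (X w) w = m].
Proof.
rewrite (_ : [set w | _] = \bigcup_K \bigcap_(N in [set N | (K <= N)%N]) EN N).
  apply: bigcupT_measurable => K; apply: bigcap_measurable => [|N _] //.
  by exists K => /=.
apply/seteqP; split => w /=.
  move=> Ew; have [K _ HK] := EN_E w; exists K => // N /HK.
  by rewrite /EN/= => ->.
move=> [K _ HK]; have [K' _ HK'] := EN_E w.
rewrite -(HK' (maxn K K')); last exact: leq_maxr.
by apply: HK; exact: leq_maxl.
Qed.

(** The identity holds for the grid-valued times [XN N], by summation over the
    cells; both sides converge by dominated convergence. *)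
Lemma probability_mixture :
  P [set w | M (X w) w = m] = (\int[P]_w (g (X w))%:E)%E.
Proof.
have int1 : P.-integrable setT (cst 1%E : T -> \bar R).
  exact: finite_measure_integrable_cst.
have mE := measurable_mixture.
have [_ _ cE] : [/\ P.-integrable setT (fun w => (\1_E w)%:E),
    [sequence \int[P]_w `|(\1_(EN N) w)%:E - (\1_E w)%:E|]_N @ \oo --> 0 &
    [sequence \int[P]_w (\1_(EN N) w)%:E]_N @ \oo --> \int[P]_w (\1_E w)%:E]%E.
  apply: (@dominated_convergence _ _ _ P setT measurableT _ _ (cst 1%E)) => //.
  - by move=> N; apply/measurable_EFinP/measurable_indic.
  - by apply/measurable_EFinP/measurable_indic.
  - apply: aeW => w _; apply: cvg_near_cst.
    apply: filterS (EN_E w) => N EN_w; congr (_%:E).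
    rewrite !indicE; congr (_%:R); congr nat_of_bool.
    by apply/idP/idP; rewrite !inE /EN /E /= EN_w.
  - apply: aeW => w N _ /=; rewrite lee_fin indicE.
    by case: (_ \in _); rewrite ?normr1 ?normr0.
have [_ _ cg'] : [/\ P.-integrable setT (fun w => (g (X w))%:E),
    [sequence \int[P]_w `|(g (XN N w))%:E - (g (X w))%:E|]_N @ \oo --> 0 &
    [sequence \int[P]_w (g (XN N w))%:E]_N @ \oo --> \int[P]_w (g (X w))%:E]%E.
  apply: (@dominated_convergence _ _ _ P setT measurableT _ _ (cst 1%E)) => //.
  - apply/measurable_EFinP/measurableT_comp => //.
    exact: continuous_measurable_fun.
  - apply: aeW => w _; apply/fine_cvgP; split; first exact: nearW.
    apply: (@cvg_comp _ _ _ (XN ^~ w) g _ _ _ (@XN_cvg w)).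
    by apply: cvg_at_right_filter; exact: cg.
  - apply: aeW => w N _ /=; rewrite lee_fin ger0_norm ?g_ge0 ?g_le1//;
    exact: grid_ge0.
move: cE; rewrite integral_indic// setIT => cE.
apply: (cvg_unique (@ereal_hausdorff R) cE); apply: cvg_trans cg'.
apply: near_eq_cvg; apply: nearW => N /=.
by rewrite -PEN integral_indic// setIT.
Qed.
End Mixture.

(** * First passage times *)

Section RightConstant.
Context {R : realType} {T : Type}.

(** Right-continuity of integer-valued paths. *)
Definition right_constant (N : R -> T -> nat) :=
  forall w (t : R), 0 <= t -> \forall u \near t^'+, N u w = N t w.

Lemma nat_right_constant (N : R -> T -> nat) :
  (forall w t, 0 <= t -> (N u w)%:R @[u --> t^'+] --> ((N t w)%:R : R)) ->
  right_constant N.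
Proof.
move=> cN w t t0; have /cvgrPdist_lt/(_ 1 ltr01) := cN w t t0.
apply: filterS => u; rewrite ltr_distlC => /andP[].
by rewrite ltrBlDr !natr1 !ltr_nat; lia.
Qed.

(** When [u] decreases to [t], [D u w] decreases to [D t w] and may already have
    reached it: right-continuity of [N] is used in the other case only. *)
Lemma time_changed_right_constant (N : R -> T -> nat) (D : R -> T -> R) :
  right_constant N -> (forall w s t, 0 <= s -> s <= t -> D s w <= D t w) ->
  (forall w t, 0 <= t -> 0 <= D t w) ->
  (forall w t, 0 <= t -> D u w @[u --> t^'+] --> D t w) ->
  right_constant (time_changed N D).
Proof.
move=> rcN D_nd D0 rcD w t t0; rewrite /time_changed.
have [e /= e0 eN] := rcN w _ (D0 w t t0).
have /cvgrPdist_lt/(_ e e0) := rcD w t t0.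
move=> H; near=> u.
have tu : t <= u by apply: ltW; near: u; exact: nbhs_right_gt.
have := D_nd w t u t0 tu; rewrite le_eqVlt => /predU1P[->//|Dtu].
by apply: eN => //=; near: u.
Unshelve. all: by end_near. Qed.

Lemma rat_right_witness (N : R -> T -> nat) w (t s : R) :
  right_constant N -> 0 <= t -> t < s ->
  exists q : rat, [/\ t < ratr q, ratr q < s & N (ratr q) w = N t w].
Proof.
move=> rcN t0 ts; have [e /= e0 eN] := rcN w t t0.
have tm : t < Num.min s (t + e) by rewrite lt_min ts ltrDl.
have [q] := rat_in_itvoo tm; rewrite in_itv/= lt_min => /and3P[tq qs qe].
exists q; split => //; apply: eN => //=.
by rewrite distrC gtr0_norm ?subr_gt0// ltrBlDl.
Qed.

(** If no such [u] exists, the path stays below [n] up to [s], hence up to some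
    [s + e], and the infimum is at least [s + e]. *)
Lemma first_passage_leP (N : R -> T -> nat) n w (s : R) :
  right_constant N -> 0 <= s ->
  (first_passage N n w <= s%:E)%E <->
  exists u, [/\ 0 <= u, u <= s & (n <= N u w)%N].
Proof.
move=> rcN s0; split=> [Hs|[u [u0 us nu]]]; last first.
  by apply: le_trans (_ : (u%:E <= _)%E); [apply: ereal_inf_lbound; exists u|].
apply: contrapT => noex.
have [e /= e0 eN] := rcN w s s0.
suff : ((s + e)%:E <= first_passage N n w)%E.
  by move/le_trans => /(_ _ Hs); rewrite lee_fin gerDl leNgt e0.
apply: le_ereal_inf_tmp => _ [u [u0 nu] <-].
rewrite lee_fin leNgt; apply/negP => use.
have [us|su] := leP u s; first by apply: noex; exists u.
apply: noex; exists s; split => //; rewrite -(eN u)//=.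
by rewrite distrC gtr0_norm ?subr_gt0// ltrBlDl.
Qed.

(** A countable union, which makes the event measurable. *)
Lemma first_passage_leE (N : R -> T -> nat) n (s : R) :
  right_constant N -> 0 <= s ->
  [set w | (first_passage N n w <= s%:E)%E] =
  [set w | (n <= N s w)%N] `|`
  \bigcup_(q : rat)
    [set w | [/\ 0 <= ratr q :> R, ratr q < s & (n <= N (ratr q) w)%N]].
Proof.
move=> rcN s0; apply/seteqP; split => w /=.
  move=> /(first_passage_leP _ _ rcN s0)[u [u0 us nu]].
  move: us; rewrite le_eqVlt => /predU1P[us|us]; first by left; rewrite -us.
  have [q [uq qs Nq]] := rat_right_witness w rcN u0 us.
  right; exists q => //; split => //; last by rewrite Nq.
  exact: le_trans u0 (ltW uq).
move=> [ns|[q _ [q0 qs nq]]]; apply/(first_passage_leP _ _ rcN s0).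
  by exists s.
by exists (ratr q); split => //; exact: ltW.
Qed.

End RightConstant.

Section FirstPassage.
Context {R : realType} {d : measure_display} {T : measurableType d}.
Variable P : probability T R.

Let decreaseE (M : R -> T -> nat) (a b : R) :
  [set w | (M b w < M a w)%N] =
  ((fun w => (M b w)%:R) \- (fun w => (M a w)%:R)) @^-1`
    `]-oo, (0 : R)[%classic.
Proof.
by apply/seteqP; split => w; rewrite /preimage/= in_itv/= subr_lt0 ltr_nat.
Qed.

(** The increment has the law of [M (b - a)], which is nonnegative. *)
Lemma stationary_nat_nondecreasing (M : R -> T -> nat) (a b : R) :
  stationary_increments P (fun t w => (M t w)%:R : R) -> 0 <= a -> a <= b ->
  P [set w | (M b w < M a w)%N] = 0%E.
Proof.
move=> st a0 ab; have ba0 : 0 <= b - a by rewrite subr_ge0.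
have := st (b - a) a ba0 a0 `]-oo, 0[%classic (measurable_itv _).
rewrite subrKC decreaseE => ->; rewrite (_ : _ @^-1` _ = set0) ?measure0//.
by apply/seteqP; split => w //; rewrite /preimage/= in_itv/= ltNge ler0n.
Qed.

(** The exceptional set is the union over pairs of rational times, which suffices
    by right-continuity. *)
Lemma stationary_nat_ae_nondecreasing (M : R -> T -> nat) :
  (forall t, 0 <= t -> measurable_fun setT (fun w => (M t w)%:R : R)) ->
  stationary_increments P (fun t w => (M t w)%:R : R) -> right_constant M ->
  exists B, [/\ measurable B, P B = 0%E &
    forall w, ~ B w -> forall x y, 0 <= x -> x <= y -> (M x w <= M y w)%N].
Proof.
move=> mM st rcM.
pose F k : set T := if unpickle k is Some pq then
   let: (p, q) := (pq : rat * rat) in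
   if (0 <= p) && (p <= q) then [set w | (M (ratr q) w < M (ratr p) w)%N]
   else set0 else set0.
have mF k : measurable (F k).
  rewrite /F; case: (unpickle k) => [[p q]|//].
  case: ifPn => // /andP[p0 pq].
  have q0 : 0 <= q by exact: le_trans pq.
  rewrite decreaseE -[X in measurable X]setTI.
  by apply: measurable_funB => //; apply: mM; rewrite ler0q.
have PF k : P (F k) = 0%E.
  rewrite /F; case: (unpickle k) => [[p q]|]; last by rewrite measure0.
  case: ifPn => [/andP[p0 pq]|_]; last by rewrite measure0.
  by apply: stationary_nat_nondecreasing => //; rewrite ?ler0q ?ler_rat.
have mB : measurable (\bigcup_k F k) by exact: bigcupT_measurable.
exists (\bigcup_k F k); split => //.
  apply/negligibleP => //; apply: negligible_bigcup => k.
  by apply/negligibleP => //; exact: PF.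
move=> w nBw x y x0; rewrite le_eqVlt => /predU1P[->//|xy].
have [p [xp py Mp]] := rat_right_witness w rcM x0 xy.
have [q [yq _ Mq]] := rat_right_witness w rcM (le_trans x0 (ltW xy))
  (ltr_pwDr ltr01 (lexx y)).
rewrite -Mp -Mq leqNgt; apply/negP => Mqp; apply: nBw.
exists (pickle (p, q)); first by [].
rewrite /F pickleK.
have p0 : 0 <= p by rewrite -(ler0q R) (le_trans x0 (ltW xp)).
have pq : p <= q by rewrite -(ler_rat R) (ltW (lt_trans py yq)).
by rewrite p0 pq /=.
Qed.

Lemma probability_first_passage (N : R -> T -> nat) n (s : R) (B : set T) :
  right_constant N ->
  (forall t, 0 <= t -> measurable [set w | (n <= N t w)%N]) ->
  measurable B -> P B = 0%E ->
  (forall w, ~ B w -> forall x y, 0 <= x -> x <= y -> (N x w <= N y w)%N) ->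
  0 <= s ->
  P [set w | (first_passage N n w <= s%:E)%E] = P [set w | (n <= N s w)%N].
Proof.
move=> rcN mN mB PB ndN s0; have E := first_passage_leE n rcN s0.
have mU : measurable (\bigcup_(q : rat)
    [set w | [/\ 0 <= ratr q :> R, ratr q < s & (n <= N (ratr q) w)%N]]).
  apply: bigcupT_measurable_rat => q.
  have [q0|q0] := boolP (0 <= (ratr q : R)); last first.
    by rewrite (_ : [set _ | _] = set0)//; apply/seteqP; split => w // [].
  have [qs|qs] := boolP (ratr q < s); last first.
    by rewrite (_ : [set _ | _] = set0)//; apply/seteqP; split => w // [].
  rewrite (_ : [set _ | _] = [set w | (n <= N (ratr q) w)%N]); first exact: mN.
  by apply/seteqP; split => w // [].
have mns := mN s s0.
rewrite E; apply/eqP; rewrite eq_le; apply/andP; split; last first.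
  apply: le_measure; rewrite ?inE; [exact: mns|exact: measurableU|].
  by move=> w; left.
rewrite -(measureU0 mns mB PB).
apply: le_measure; rewrite ?inE; [exact: measurableU|exact: measurableU|].
move=> w [nw|[q _ [q0 qs nq]]]; first by left.
have [Bw|nBw] := pselect (B w); first by right.
by left; apply: leq_trans nq (ndN w nBw _ _ q0 (ltW qs)).
Qed.

End FirstPassage.

(** * Derivatives on the half-line *)

Section Halfline.
Context {R : realType}.

Lemma is_derive_halfline_restrict (g h : R -> R) (t l : R) :
  (forall u, 0 <= u -> g u = h u) -> 0 <= t -> is_derive t 1 h l ->
  is_derive_on_halfline g t l.
Proof.
move=> gh t0 [dh <-].
have H : (fun u => u^-1 * (h (t + u) - h t)) @ (0 : R)^' --> 'D_1 h t.
  rewrite (_ : (fun u => _) =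
    (fun u => u^-1 *: ((h \o shift t) (u *: 1) - h t))).
    exact: dh.
  by apply/funext => u; rewrite /= [u *: 1]mulr1 (addrC u).
rewrite /is_derive_on_halfline; apply: cvg_trans (cvg_within_filter _ H).
apply: near_eq_cvg; rewrite near_withinE; near=> u => tu.
by rewrite !gh.
Unshelve. all: by end_near. Qed.

(** Makes derivatives on the half-line unique, also at [t = 0]. *)
Lemma halfline_proper (t : R) : 0 <= t ->
  ProperFilter (within [set h | 0 <= t + h] (0 : R)^').
Proof.
move=> t0; apply: Build_ProperFilter_ex => A.
rewrite /within /= => -[e /= e0 eA].
have e2 : 0 < e / 2 by rewrite divr_gt0.
exists (e / 2); apply: eA; rewrite /= ?gt_eqF// ?addr_ge0 ?(ltW e2)//.
by rewrite /ball/= sub0r normrN gtr0_norm// gtr_pMr// invf_lt1// ltr1n.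
Qed.

Lemma derive_on_halflineE (g : R -> R) (t l : R) : 0 <= t ->
  is_derive_on_halfline g t l -> derive_on_halfline g t = l.
Proof.
move=> t0; rewrite /is_derive_on_halfline /derive_on_halfline.
have := halfline_proper t0 => FF.
exact: cvg_lim.
Qed.

End Halfline.

(** * The differential system *)

Section Tail.
Context {R : realType} {d : measure_display} {T : measurableType d}.
Variables (P : probability T R) (N : T -> nat) (q : nat -> R).
Hypothesis mN : forall m, measurable [set w | N w = m].
Hypothesis PN : forall m, P [set w | N w = m] = (q m)%:E.

Lemma measurable_tail n : measurable [set w | (n <= N w)%N].
Proof.
rewrite (_ : [set w | _] =
  \bigcup_(m in [set m | (n <= m)%N]) [set w | N w = m]).
  by apply: bigcup_measurable.
apply/seteqP; split => w /=; first by move=> nw; exists (N w).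
by move=> [m /= nm ->].
Qed.

Lemma probability_tail n :
  P [set w | (n <= N w)%N] = (1 - \sum_(m < n) q m)%:E.
Proof.
elim: n => [|n IH].
  rewrite big_ord0 subr0 (_ : [set w | _] = setT) ?probability_setT//.
  by apply/seteqP; split.
have E : P [set w | (n <= N w)%N] = (P [set w | (n < N w)%N] + (q n)%:E)%E.
  rewrite -PN -measureU//; last 2 first.
  - exact: (measurable_tail n.+1).
  - by apply/seteqP; split => w //= [] /[swap] ->; rewrite ltnn.
  congr (P _); apply/seteqP; split => w /=.
    by rewrite leq_eqVlt => /predU1P[|]; [right|left].
  by case=> [/ltnW//|->].
by rewrite big_ord_recr/= opprD addrA EFinB -IH E addeK.
Qed.

End Tail.

Section System.
Context {R : realType} (k : nat) (lam : 'I_k -> R).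
Variables (f : R -> R).
Let Lam := total_rate lam.
Hypothesis Lam0 : 0 < Lam.
Hypothesis sf : smooth_pos f.
Hypothesis se : forall t, smooth_pos (exp_exponent f t).

(** The coefficient of [B ^ m] in [f (Lambda - sum_j lam_j B^j)]. *)
Definition shift_coef m : R := omega_sum lam m (fun z => derive1n z f Lam).

(** The coefficient of [u ^ m] in [exp (- t f (Lambda - sum_j lam_j u^j))]. It is
    defined for all real [t], which allows two-sided derivatives at [t = 0]; for
    [t >= 0] it is the probability of state [m] ([expectation_gcp_pmf]). *)
Definition state_prob t m : R :=
  omega_sum lam m (fun z => z`!%:R * taylor (exp_exponent f t) z Lam).

Lemma state_prob_derive m (t : R) :
  is_derive t 1 (state_prob ^~ m) (- seqconv shift_coef (state_prob t) m).
Proof.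
have eta0 u :
    taylor (exp_exponent f u) 0%N Lam = expR (- (u * taylor f 0%N Lam)).
  by rewrite /taylor fact0 invr1 !mul1r.
have etaS u z := taylor_exp (t := u) z sf (@se u) Lam0.
have D := exp_family_derive eta0 etaS.
have -> : - seqconv shift_coef (state_prob t) m =
   omega_sum lam m (fun z => z`!%:R *
     - seqconv (taylor f ^~ Lam) (taylor (exp_exponent f t) ^~ Lam) z).
  rewrite -[LHS]mulN1r.
  rewrite [seqconv _ _ _](eq_seqconv
    (a' := fun i => omega_sum lam i (fun z => z`!%:R * taylor f z Lam))
    (b' := fun i => omega_sum lam i
      (fun z => z`!%:R * taylor (exp_exponent f t) z Lam)))//; last first.
    by move=> i _; apply: eq_bigr => x _; rewrite fact_taylor.
  rewrite -omega_sum_seqconv /omega_sum mulr_sumr; apply: eq_bigr => x _.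
  by rewrite mulN1r mulrN mulNr.
rewrite /state_prob /omega_sum.
apply: is_derive1_sum => x.
apply: (@is_derive1_eq _ (fun u => omega_weight lam x *
  ((omega_deg x)`!%:R * taylor (exp_exponent f u) (omega_deg x) Lam))).
- by move=> u; rewrite mulrC.
- exact: mulrC.
Qed.

Definition tail_density t n : R :=
  \sum_(m < n) seqconv shift_coef (state_prob t) m.

Lemma tail_derive n (t : R) :
  is_derive t 1 (fun u => 1 - \sum_(m < n) state_prob u m) (tail_density t n).
Proof.
have dQ :
    is_derive t 1 (fun u => \sum_(m < n) state_prob u m) (- tail_density t n).
  rewrite /tail_density -sumrN; apply: is_derive1_sum => m.
  exact: state_prob_derive.
have := is_deriveB (is_derive_cst (1 : R) t 1) dQ.
by rewrite sub0r opprK.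
Qed.

Lemma tail_density_derive n (t : R) :
  is_derive t 1 (tail_density ^~ n) (- seqconv shift_coef (tail_density t) n).
Proof.
rewrite -(sum_seqconv shift_coef (seqconv shift_coef (state_prob t))).
rewrite -sumrN /tail_density.
apply: is_derive1_sum => m; rewrite -seqconvNr.
apply: is_derive1_sum => i; apply: is_derive1Ml; exact: state_prob_derive.
Qed.

Lemma shift_coef0 : shift_coef 0 = f Lam.
Proof.
rewrite /shift_coef /omega_sum (big_pred1 [ffun=> ord0]); last first.
  move=> x; rewrite inE; apply/eqP/eqP => [_|->].
    by apply/ffunP => j; rewrite ffunE; apply: ord1.
  by rewrite big1// => j _; rewrite ffunE muln0.
rewrite /omega_deg /omega_weight !big1 ?mulr1// => j _; rewrite ffunE//.
by rewrite expr0 fact0 divr1.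
Qed.

Lemma bernstein_shift_opE (p : nat -> R -> R) n t : p 0%N t = 0 ->
  bernstein_shift_op f lam p n t = seqconv shift_coef (p ^~ t) n.
Proof.
move=> p0; rewrite /bernstein_shift_op /seqconv big_ord_recl subn0 shift_coef0.
congr (_ + _); rewrite big_add1 /= big_mkord; apply: eq_bigr => i _.
by rewrite mulr_suml.
Qed.

(** The sign compensates the sign of the rates in the weights. *)
Lemma gcp_pmf_moment (t : R) m :
  gcp_pmf lam t m = \sum_(x in Omega k m)
    ((-1) ^+ omega_deg x * omega_weight lam x) *
    (t ^+ omega_deg x * expR (- (Lam * t))).
Proof.
apply: eq_bigr => x _; rewrite mulrA; congr (_ * _).
rewrite /omega_deg /omega_weight -!prodrXr -!big_split/=; apply: eq_bigr => j _.
by rewrite exprMn (exprNn (lam j)) !mulrA -expr2 sqrr_sign mul1r mulrAC.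
Qed.

End System.

(** * The law of the subordinated process *)

Section Law.
Context {R : realType}.

Lemma is_derive_continuous (f : R -> R) (t l : R) :
  is_derive t 1 f l -> {for t, continuous f}.
Proof.
move=> df; apply: differentiable_continuous; apply/derivable1_diffP.
exact: ex_derive.
Qed.

Lemma gcp_pmf_continuous k (lam : 'I_k -> R) m :
  continuous (fun t => gcp_pmf lam t m).
Proof.
move=> t; rewrite (_ : (fun t => _) = fun t => \sum_(x in Omega k m)
    ((-1) ^+ omega_deg x * omega_weight lam x) *
    (t ^+ omega_deg x * expR (- (total_rate lam * t)))); last first.
  by apply/funext => u; exact: gcp_pmf_moment.
apply: (continuous_big (op := +%R)) => [|x _ u]; first exact: add_continuous.
apply: cvgM; first exact: cvg_cst.
apply: cvgM; first exact: exprn_continuous.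
apply: (@continuous_comp _ _ _ (fun u => - (total_rate lam * u)) expR).
  by apply: cvgN; exact: mulrl_continuous.
exact: continuous_expR.
Qed.

Lemma integral_tail_density k (lam : 'I_k -> R) (f : R -> R) n (s : R) :
  0 < total_rate lam -> smooth_pos f ->
  (forall t, smooth_pos (exp_exponent f t)) ->
  0 <= s ->
  (\int[lebesgue_measure]_(u in `[0%R, s]) (tail_density lam f u n)%:E =
   (1 - \sum_(m < n) state_prob lam f s m)%:E -
   (1 - \sum_(m < n) state_prob lam f 0 m)%:E)%E.
Proof.
move=> L0 sf se; rewrite le_eqVlt => /predU1P[<-|s0].
  by rewrite set_itv1 integral_set1 subee.
have dF := tail_derive L0 sf se n.
have cF t := is_derive_continuous (dF t).
have cp t := is_derive_continuous (tail_density_derive L0 sf se n t).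
apply: (@continuous_FTC2 R (fun u => tail_density lam f u n)
  (fun u => 1 - \sum_(m < n) state_prob lam f u m) 0 s s0).
- by apply: continuous_subspaceT => x; exact: cp.
- split.
  + by move=> x _; apply: ex_derive; exact: dF.
  + by apply: cvg_at_right_filter; exact: cF.
  + by apply: cvg_at_left_filter; exact: cF.
- by move=> x _; rewrite derive1E; apply: derive_val.
Qed.

End Law.

Section Subordinated.
Context {R : realType} {d : measure_display} {T : measurableType d}.
Variables (P : probability T R) (D : R -> T -> R) (f : R -> R).
Variables (k : nat) (lam : 'I_k -> R).
Hypothesis Lam0 : 0 < total_rate lam.
Hypothesis mD : forall t, 0 <= t -> measurable_fun setT (D t).
Hypothesis D0 : forall t w, 0 <= t -> 0 <= D t w.
Hypothesis laplaceD : forall s t, 0 <= s -> 0 <= t ->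
  laplace_moment P (D t) 0 s = expR (- (t * f s)).

Lemma expectation_gcp_pmf t m : 0 <= t ->
  (\int[P]_w (gcp_pmf lam (D t w) m)%:E)%E = (state_prob lam f t m)%:E.
Proof.
move=> t0.
have int z := integrable_pow_expR P (mD t0) (fun w => D0 w t0) z Lam0.
under eq_integral do rewrite gcp_pmf_moment -sumEFin.
rewrite integral_sum//=; last first.
  move=> x; under eq_fun do rewrite EFinM.
  by apply: integrableZl => //; exact: int.
rewrite /state_prob /omega_sum -sumEFin; apply: eq_bigr => x _.
under eq_integral do rewrite EFinM.
rewrite integralZl//; last exact: int.
rewrite -(fineK (integrable_fin_num measurableT (int (omega_deg x)))).
rewrite -[fine _]/(laplace_moment P (D t) (omega_deg x) (total_rate lam)).
rewrite (laplace_momentE mD D0 laplaceD)// -EFinM; congr (_%:E).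
by rewrite mulrACA -expr2 sqrr_sign mul1r mulrC.
Qed.

End Subordinated.

Theorem theorem5p1 (R : realType) (d : measure_display) (T : measurableType d)
  (P : probability T R)
  (k : nat) (hk : (0 < k)%N) (lam : 'I_k -> R) (hlam : forall j, 0 < lam j)
  (M : R -> T -> nat) (hM : generalized_counting_process P lam M)
  (c2 : R) (hc2 : 0 <= c2)
  (nu : {measure set (measurableTypeR R) -> \bar R}) (hnu : levy_measure nu)
  (D : R -> T -> R) (hD : levy_subordinator P (bernstein c2 nu) D)
  (hMD : independent_processes P (fun t w => (M t w)%:R) D) :
  let Mf := time_changed M D in
  let p := passage_density P Mf in
  forall n, (0 < n)%N ->
    (forall s, 0 <= s ->
       P [set w | (first_passage Mf n w <= s%:E)%E] =
       (\int[lebesgue_measure]_(u in `[0%R, s]) (p n u)%:E)%E) /\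
    (forall t, 0 <= t ->
       is_derive_on_halfline (p n) t
         (- bernstein_shift_op (bernstein c2 nu) lam p n t)).
Proof.
move=> Mf p n n0; set f := bernstein c2 nu.
have Lam0 : 0 < total_rate lam.
  case: k hk lam hlam {hM} => // k' _ lam' lam0.
  rewrite /total_rate big_ord_recl ltr_pwDl ?lam0// sumr_ge0// => j _.
  exact: ltW.
have LM := gcp_levy hM; have LD := subordinator_levy hD.
have mD t (t0 : 0 <= t) := levy_measurable LD t0.
have D_nd := subordinator_nondecreasing hD.
have D0 t w : 0 <= t -> 0 <= D t w.
  by move=> t0; rewrite -(levy_0 LD w); exact: D_nd.
have laplaceD s t : 0 <= s -> 0 <= t ->
    laplace_moment P (D t) 0 s = expR (- (t * f s)).
  move=> s0 t0; rewrite /laplace_moment /Rintegral.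
  under eq_integral do rewrite expr0 mul1r.
  by have := subordinator_laplace hD s0 t0; rewrite unlock => ->.
have sf := laplace_exponent_smooth mD D0 laplaceD.
have se := exp_exponent_smooth mD D0 laplaceD.
have rcM : right_constant M.
  by apply: nat_right_constant => w t t0; exact: (levy_cadlag LM w).1.
have rcMf : right_constant Mf.
  apply: time_changed_right_constant => // w t t0; first exact: D0.
  exact: (levy_cadlag LD w).1.
have ME t m : [set w | M t w = m] = (fun w => (M t w)%:R) @^-1` [set m%:R : R].
  by apply/seteqP; split => w /=; [move=> ->|move/eqP; rewrite eqr_nat => /eqP].
have mM m t : 0 <= t -> measurable [set w | M t w = m].
  by move=> t0; rewrite ME -[_ @^-1` _]setTI; exact: (levy_measurable LM t0).
have ind m s t A : 0 <= s -> 0 <= t -> measurable A ->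
    P ([set w | M t w = m] `&` D s @^-1` A) =
    (P [set w | M t w = m] * P (D s @^-1` A))%E.
  move=> s0 t0 mA; apply: hMD; apply: sub_sigma_algebra.
    by exists t, [set m%:R]; split => //; exact: ME.
  by exists s, A.
have pM m t : 0 <= t -> P [set w | M t w = m] = (gcp_pmf lam t m)%:E.
  exact: gcp_law.
have mMf m t : 0 <= t -> measurable [set w | Mf t w = m].
  move=> t0; apply: (measurable_mixture rcM (mM m) (mD t t0)) => w; exact: D0.
have pMf m t : 0 <= t -> P [set w | Mf t w = m] = (state_prob lam f t m)%:E.
  move=> t0; rewrite -(expectation_gcp_pmf Lam0 mD D0 laplaceD)//.
  apply: (probability_mixture rcM (mM m) (pM m) (mD t t0)) => //.
  - by move=> w; exact: D0.
  - by move=> u A u0; exact: ind.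
  - exact: gcp_pmf_continuous.
have tailE m t : 0 <= t ->
    P [set w | (m <= Mf t w)%N] = (1 - \sum_(i < m) state_prob lam f t i)%:E.
  by move=> t0; apply: probability_tail => i; [exact: mMf|exact: pMf].
have pE m t : 0 <= t -> p m t = tail_density lam f t m.
  move=> t0; rewrite /p /passage_density; case: eqP => [->|_].
    by rewrite /tail_density big_ord0.
  apply: derive_on_halflineE => //.
  apply: is_derive_halfline_restrict t0 (tail_derive Lam0 sf se m t) => u u0.
  by rewrite tailE.
split => [s s0|t t0].
  have [B [mB PB ndB]] :=
    stationary_nat_ae_nondecreasing (@levy_measurable _ _ _ _ _ LM)
      (levy_stationary LM) rcM.
  rewrite (@probability_first_passage _ _ _ _ _ _ _ B)//; last 2 first.
  - by move=> t t0; apply: measurable_tail => m; exact: mMf.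
  - move=> w nBw x y x0 xy; apply: ndB => //; first exact: D0.
    exact: D_nd.
  transitivity (\int[lebesgue_measure]_(u in `[0%R, s])
    (tail_density lam f u n)%:E)%E; last first.
    by apply: eq_integral => u; rewrite inE/= in_itv/= => /andP[u0 _];
      rewrite pE.
  rewrite integral_tail_density// -!tailE//.
  rewrite (_ : [set w | (n <= Mf 0%R w)%N] = set0) ?measure0 ?sube0//.
  apply/seteqP; split => w //=; rewrite /Mf /time_changed (levy_0 LD).
  have /eqP := levy_0 LM w; rewrite pnatr_eq0 => /eqP ->.
  by rewrite leqNgt n0.
rewrite (@bernstein_shift_opE _ _ lam f p)//.
rewrite (eq_seqconv (a' := shift_coef lam f)
  (b' := tail_density lam f t))//; last first.
  by move=> i _; exact: pE.
apply: is_derive_halfline_restrict t0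
  (tail_density_derive Lam0 sf se n t) => u u0.
exact: pE.
Qed.
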